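(* For each $n$ let $\mathbf{p}=\mathbf{p}^{(n)}=\{p_{ij}\}_{i,j\in[n]}$ be a collection of edge probabilities and let $s=s_n\in[0,1]$, and let $(G_1,G_2)$ be a pair of correlated inhomogeneous random graphs on $[n]$ with parameters $(\mathbf{p},s)$ and latent permutation $\pi_*$. Let $p_{\max}:=\max_{i,j\in[n]}p_{ij}$ and $$R:=\frac{(n-1)p_{\max}}{\min_{i\in[n]}\sum_{j=1}^n p_{ij}} .$$ Suppose that $p_{\max}=n^{-1+o(1)}$ and $k=13$. Let $(\widehat M_k,\widehat\mu_k)$ be the $k$-core estimator of $(G_1,G_2)$. If $$\min_{i\in[n]}\sum_{j=1}^n p_{ij}s^2\ge\max\{R,154\},$$ then with probability $1-o(1)$ as $n\to\infty$ it holds that $$|\widehat M_k|\ge\Bigl(1-3e^{-\min_{i\in[n]}\sum_{j=1}^n p_{ij}s^2/7}\Bigr)n-o(n)\quad\text{and}\quad\widehat\mu_k\{\widehat M_k\}=\pi_*\{\widehat M_k\}.$$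
   Context: Edge probabilities: $\mathbf{p}=\{p_{ij}\}_{i,j\in[n]}$ with $p_{ij}\in[0,1]$, $p_{ij}=p_{ji}$, $p_{ii}=0$. The inhomogeneous random graph with parameter $\mathbf{p}$ is the simple undirected random graph on $[n]$ in which each edge $\{i,j\}$ is present with probability $p_{ij}$, independently over unordered pairs. Correlated inhomogeneous random graphs with parameters $(\mathbf{p},s)$: generate an inhomogeneous random graph $G$ with parameter $\mathbf{p}$; conditionally on $G$, generate $G_1$ and $G_2'$ independently, each keeping every edge of $G$ independently with probability $s$ (same vertex set $[n]$); finally let $\pi_*$ be an independent uniformly random permutation of $[n]$ and let $G_2$ be $G_2'$ with vertices relabelled by $\pi_*$, so that $\{\pi_*(i),\pi_*(j)\}$ is an edge of $G_2$ iff $\{i,j\}$ is an edge of $G_2'$. A matching is a pair $(M,\mu)$ with $M\subseteq[n]$ and $\mu:M\to[n]$ injective. $G_1\wedge_\mu G_2$ is the graph on vertex set $M$ in which $\{i,j\}$ is an edge iff $\{i,j\}$ is an edge of $G_1$ and $\{\mu(i),\mu(j)\}$ is an edge of $G_2$. A matching is a $k$-core matching if every vertex of $G_1\wedge_\mu G_2$ has degree at least $k$ (the empty matching qualifies vacuously). The $k$-core estimator $(\widehat M_k,\widehat\mu_k)$ is a $k$-core matching of $(G_1,G_2)$ with $|M|$ as large as possible among all $k$-core matchings (ties broken arbitrarily). For a map $\mu$ and a subset $S$ of its domain, $\mu\{S\}:=\{(i,\mu(i)):i\in S\}$. $p_{\max}=n^{-1+o(1)}$ means $p_{\max}=n^{-1+\varepsilon_n}$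 for some deterministic sequence $\varepsilon_n\to0$; the $o(n)$ term denotes a deterministic sequence $a_n$ with $a_n/n\to0$. *)

(* Defs.v *)
(* MathComp-Analysis, over an arbitrary R : realType.  All random objects are
   finite, so probabilities are finite sums over finTypes. *)
From HB Require Import structures.
From mathcomp Require Import all_boot all_order all_algebra all_fingroup.
From mathcomp Require Import all_classical all_reals all_analysis.
Set Implicit Arguments.
Unset Strict Implicit.
Unset Printing Implicit Defensive.
Import Order.TTheory GRing.Theory Num.Theory.
Import numFieldNormedType.Exports.
Local Open Scope ring_scope.

Record sgraph (n : nat) := SGraph {
  edges : {set {set 'I_n}};
  edges_card2 : [forall e in edges, #|e| == 2]
}.

HB.instance Definition _ (n : nat) := [isSub for @edges n].
HB.instance Definition _ (n : nat) := [Finite of sgraph n by <:].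

Definition adj (n : nat) (G : sgraph n) : rel 'I_n :=
  fun i j => [set i; j] \in edges G.

Lemma relabel_card2 (n : nat) (pi : 'S_n) (G : sgraph n) :
  [forall e in [set pi @: (e : {set 'I_n}) | e in edges G]%SET, #|e| == 2].
Proof.
apply/forallP => e; apply/implyP => /imsetP[e' e'G ->].
rewrite card_imset; last exact: perm_inj.
by move/forallP: (edges_card2 G) => /(_ e'); rewrite e'G.
Qed.

Definition relabel (n : nat) (pi : 'S_n) (G : sgraph n) : sgraph n :=
  SGraph (relabel_card2 pi G).

Section RandomGraphs.
Variable R : realType.

Definition edge_probabilities (n : nat) (p : 'I_n -> 'I_n -> R) : Prop :=
  [/\ forall i j, 0 <= p i j <= 1,
      forall i j, p i j = p j i
    & forall i, p i i = 0].

(* The default value 0 is harmless since the entries are nonnegative. *)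
Definition pmax (n : nat) (p : 'I_n -> 'I_n -> R) : R :=
  \big[Num.max/0]_(i < n) \big[Num.max/0]_(j < n) p i j.

(* The infimum of a finite set: the minimum as soon as 0 < n. *)
Definition min_row_sum (n : nat) (p : 'I_n -> 'I_n -> R) : R :=
  inf (range (fun i : 'I_n => \sum_(j < n) p i j))%classic.

Definition heterogeneity (n : nat) (p : 'I_n -> 'I_n -> R) : R :=
  (n%:R - 1) * pmax p / min_row_sum p.

Definition irg_law (n : nat) (p : 'I_n -> 'I_n -> R) (G : sgraph n) : R :=
  \prod_(i < n) \prod_(j < n | (i < j)%N)
    (if adj G i j then p i j else 1 - p i j).

Definition subsample_law (n : nat) (s : R) (G H : sgraph n) : R :=
  if edges H \subset edges G then
    \prod_(e in edges G) (if e \in edges H then s else 1 - s)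
  else 0.

(* Joint law of (G, G1, G2', pi): G is the parent graph, G1 and G2' are
   conditionally independent given G, pi is uniform and independent. *)
Definition corr_law (n : nat) (p : 'I_n -> 'I_n -> R) (s : R)
    (w : sgraph n * sgraph n * sgraph n * 'S_n) : R :=
  let: (G, G1, G2', pi) := w in
  irg_law p G * subsample_law s G G1 * subsample_law s G G2' * (n`!%:R)^-1.

(* Probability of an event on (G1, G2, pi), where G2 is G2' relabelled. *)
Definition corr_prob (n : nat) (p : 'I_n -> 'I_n -> R) (s : R)
    (A : sgraph n -> sgraph n -> 'S_n -> bool) : R :=
  \sum_(w : sgraph n * sgraph n * sgraph n * 'S_n |
        A w.1.1.2 (relabel w.2 w.1.2) w.2) corr_law p s w.

End RandomGraphs.

(* Only the restriction of mmap to mdom is meaningful; every injection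
   mdom -> 'I_n is the restriction of some such mmap. *)
Record matching (n : nat) := Matching {
  mdom : {set 'I_n};
  mmap : 'I_n -> 'I_n;
  mmap_inj : {in mdom &, injective mmap}
}.

Definition wedge (n : nat) (G1 G2 : sgraph n) (m : matching n) : rel 'I_n :=
  fun i j => [&& i \in mdom m, j \in mdom m, adj G1 i j
               & adj G2 (mmap m i) (mmap m j)].

Definition core_matching (n k : nat) (G1 G2 : sgraph n) (m : matching n) :
    Prop :=
  forall i, i \in mdom m -> (k <= #|[pred j | wedge G1 G2 m i j]|)%N.

(* A tie-breaking rule is a choice of est; results are to be stated for
   every est satisfying this predicate. *)
Definition core_estimator (n k : nat)
    (est : sgraph n -> sgraph n -> matching n) : Prop :=
  forall G1 G2 : sgraph n,
    core_matching k G1 G2 (est G1 G2) /\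
    forall m, core_matching k G1 G2 m -> (#|mdom m| <= #|mdom (est G1 G2)|)%N.

Definition graph_of (n : nat) (f : 'I_n -> 'I_n) (S : {set 'I_n}) :
    {set 'I_n * 'I_n} :=
  [set (i, f i) | i in S]%SET.

(* Main.v *)
Require Import Defs.
From HB Require Import structures.
From mathcomp Require Import all_boot all_order all_algebra all_fingroup.
From mathcomp Require Import all_classical all_reals all_analysis.
From mathcomp Require Import ring lra zify.
From mathcomp Require Import fintype finset.
Import Order.TTheory GRing.Theory Num.Theory.
Import numFieldNormedType.Exports.
Set Implicit Arguments.
Unset Strict Implicit.
Unset Printing Implicit Defensive.
Local Open Scope ring_scope.

(** The law of the parent graph and of its two subsamples is a product over the
    unordered pairs of vertices, so expectations of products over pairs are
    products ([expect_prod]).  Two bad events are excluded.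

    No errors.  Let a core matching [m] be given and let [g] be [pi^-1 o mmap m].
    Let [D] be the set of the [d] vertices moved by [g].  Every vertex of [D] has
    at least 13 neighbours [j] such that both [{i, j}] and [{g i, g j}] are edges
    of the parent graph: the parent graph overlaps its image under [g].  The pairs
    fixed by [g] are transpositions and account for at most [d] of the incidences,
    so 12 [d] of them come from pairs [e] with [g e <> e].  The map [e |-> g e] is
    injective on the relevant pairs, hence three colours suffice to give [e] and
    [g e] different colours, and one colour class carries 4 [d] incidences.  In
    such a class the couples [(e, g e)] are disjoint, so the exponential moment of
    the number of incidences factorises ([expect_exp_le], [overlap_tail]).  With
    all edge probabilities at most [q] this yields, after a union bound over the
    at most [C(n, d) n^d] maps [g], a bound [3 (e^3 n^7 q^8)^d]; it is summable
    over [d] and small because [q] is close to [1/n] ([overlap_union_bound]).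

    Large core.  Let [H] be the common part of the two subsamples.  Remove
    successively the vertices of degree at most 12.  If [x] vertices get removed,
    they form a set [S] of [x] vertices touched by at most [12 x] edges of [H]
    ([peeling]).  The expected number of edges touching [S] is at least
    [x lam / 2], where [lam] is the least expected degree, so a Chernoff bound
    gives probability at most [2^(12 x) exp (- x lam / 4)] for each [S].  There
    are at most [(e n / x)^x] sets [S], which is at most [exp (x lam / 7)] once
    [x >= 3 exp (- lam / 7) n]; since [lam / 4] beats [lam / 7 + 12 ln 2] when
    [lam >= 154], the union bound is at most [2^-x] ([core_union_term_le]).  What
    survives the removal, matched by [pi], is a core matching.

    The estimator is a core matching, so it makes no error; it is at least as large
    as the one built from the core, so it is large. *)

(** * Pairs of vertices and incidences *)

Definition vertex_pairs n : {set {set 'I_n}} := [set e : {set 'I_n} | #|e| == 2%N]%SET.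

Definition touching n (S : {set 'I_n}) : {set {set 'I_n}} :=
  [set e : {set 'I_n} | (e :&: S != set0)%SET]%SET.

Lemma set2_vertex_pairs n (i j : 'I_n) : j != i -> [set i; j] \in vertex_pairs n.
Proof. by move=> ji; rewrite inE cards2 (eq_sym i) ji. Qed.

Lemma edges_vertex_pairs n (G : sgraph n) : edges G \subset vertex_pairs n.
Proof.
by apply/subsetP => e eG; rewrite inE; apply: (implyP (forallP (edges_card2 G) e)).
Qed.

Lemma set2_injr (T : finType) (i : T) :
  {in [pred j | j != i] &, injective (fun j => [set i; j])}.
Proof.
move=> j k; rewrite !inE => ji ki /setP /(_ j); rewrite !inE eqxx orbT (negPf ji).
by move/esym/eqP.
Qed.

Lemma sum_star (V : nmodType) n (i : 'I_n) (f : {set 'I_n} -> V) :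
  \sum_(j | j != i) f [set i; j] = \sum_(e in vertex_pairs n | i \in e) f e.
Proof.
rewrite -(big_imset f (@set2_injr _ i)); apply: eq_bigl => e.
apply/imsetP/andP => [[j ji ->]|[]].
  by rewrite set2_vertex_pairs // set21.
rewrite inE => /cards2P[x [y [xy ->]]]; rewrite !inE => /orP[]/eqP ->.
  by exists y => //; rewrite inE eq_sym.
by exists x; rewrite ?inE // setUC.
Qed.

(** Double counting of incidences: a sum over the vertices of [S] and their
    partners counts a pair once for each endpoint in [S]. *)
Lemma sum_incident (V : nmodType) n (S : {set 'I_n}) (f : {set 'I_n} -> V) :
  \sum_(i in S) \sum_(j | j != i) f [set i; j]
    = \sum_(e in vertex_pairs n) f e *+ #|e :&: S|%SET.
Proof.
under eq_bigr do rewrite sum_star.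
rewrite (exchange_big_dep (mem (vertex_pairs n))) /=; last by move=> i e _ /andP[].
apply: eq_bigr => e eE; rewrite -sumr_const; apply: eq_bigl => i.
by rewrite in_setI (eE : e \in vertex_pairs n) andbC.
Qed.

(** Removing vertices of degree at most [k] one at a time, each removal accounts
    for at most [k] edges not yet counted.  After [x] steps either the process has
    stopped at a core, or the removed vertices touch at most [k * x] edges. *)
Lemma peeling n k (H : {set {set 'I_n}}) x : H \subset vertex_pairs n ->
  (exists M : {set 'I_n}, (n - x <= #|M|)%N /\
     forall i, i \in M -> (k < #|[set j in M | [set i; j] \in H]|)%N)
  \/ (exists S : {set 'I_n}, #|S| = x /\ (#|H :&: touching S|%SET <= k * x)%N).
Proof.
move=> /subsetP HE; elim: x => [|x [[M [Mx HM]]|[S [Sx HS]]]].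
- right; exists set0; rewrite cards0 muln0; split=> //.
  rewrite leqn0 cards_eq0; apply/eqP/setP => e; rewrite !inE.
  by rewrite setI0 eqxx andbF.
- by left; exists M; split=> //; apply: leq_trans Mx; rewrite leq_sub2l.
pose d v := [set j in ~: S | [set v; j] \in H]%SET.
have [/'exists_andP[v [vS dv]]|/negP noV] :=
  boolP [exists v, (v \in ~: S)%SET && (#|d v| <= k)%N].
- right; exists (v |: S)%SET; rewrite inE in vS; split.
    by rewrite cardsU1 vS Sx.
  rewrite mulnS addnC.
  apply: leq_trans (_ : #|(H :&: touching S) :|: [set [set v; j] | j in d v]|%SET <= _)%N.
    apply: subset_leq_card; apply/subsetP => e.
    rewrite !inE => /andP[eH et]; rewrite eH /=.
    have [//|/negPn/eqP eS] := boolP (_ != _); rewrite /=.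
    have := HE _ eH; rewrite inE => /cards2P[a [b [ab eab]]].
    suff key a1 b1 : e = [set a1; b1] -> a1 = v -> a1 != b1 ->
        e \in [set [set v; j] | j in d v]%SET.
      have [z] := set0Pn _ et; rewrite !inE => /andP[ze /orP[/eqP zv|zS]].
        have : z \in [set a; b] by rewrite -eab.
        rewrite !inE => /orP[]/eqP zz.
          by apply: (key a b) => //; rewrite -zz.
        by apply: (key b a); rewrite 1?eq_sym // 1?setUC // -zz.
      by move/setP: eS => /(_ z); rewrite !inE ze zS.
    move=> {a b ab}eab av ab; apply/imsetP; exists b1; last by rewrite eab av.
    rewrite !inE -av -eab eH andbT.
    by apply/negP => bS; move/setP: eS => /(_ b1); rewrite eab !inE eqxx orbT bS.
  apply: leq_trans (leq_card_setU _ _) _; apply: leq_add => //.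
  exact: leq_trans (leq_imset_card _ _) dv.
left; exists (~: S)%SET; split.
  by have := cardsC S; rewrite card_ord Sx; lia.
move=> i iS; rewrite ltnNge; apply/negP => di.
by apply: noV; apply/existsP; exists i; rewrite iS.
Qed.

(** The graph joining [e] to [f e] has degree at most two, because [f] is
    injective, so greedy colouring succeeds with three colours. *)
Lemma three_coloring (T : finType) (f : T -> T) (C : {set T}) :
  {in C &, injective f} -> (forall e, e \in C -> f e != e) ->
  exists c : T -> 'I_3, forall e, e \in C -> f e \in C -> c (f e) != c e.
Proof.
have [m] := ubnP #|C|; elim: m C => // m IH C Cm finj ffix.
have [->|/set0Pn[e0 e0C]] := eqVneq C set0.
  by exists (fun=> ord0) => e; rewrite inE.
have subC : {subset (C :\ e0)%SET <= C} by move=> e; rewrite !inE => /andP[].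
have [|||c Hc] := IH (C :\ e0)%SET.
- by move: Cm; rewrite (cardsD1 e0 C) e0C; lia.
- by move=> e e' /subC eC /subC e'C; apply: finj.
- by move=> e /subC; apply: ffix.
(* The neighbours of [e0] are [f e0] and at most one preimage of [e0]. *)
pose used := [set c (f e0)] :|: [set c e | e in C & f e == e0]%SET.
have usedN : (used != [set: 'I_3])%SET.
  apply/eqP => /(congr1 (fun A : {set 'I_3} => #|A|)).
  rewrite cardsT card_ord => u3.
  suff : (#|used| <= 1 + 1)%N by rewrite u3.
  apply: leq_trans (leq_card_setU _ _) _; rewrite cards1 leq_add2l.
  apply: leq_trans (leq_imset_card _ _) _.
  apply/card_le1_eqP => a b; rewrite !inE => /andP[aC /eqP fa] /andP[bC /eqP fb].
  by apply: finj => //; rewrite fa fb.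
have [c0 c0N] : exists c0, c0 \notin used.
  apply/existsP; apply: contraR usedN; rewrite negb_exists => /forallP uT.
  by apply/eqP/setP => z; rewrite in_setT; apply: negbNE; exact: uT.
move: c0N; rewrite !inE negb_or => /andP[c0f c0i].
exists (fun e => if e == e0 then c0 else c e) => e eC feC.
have [->|ee0] := eqVneq e e0; first by rewrite (negPf (ffix _ e0C)) eq_sym.
have [fe|fe] := eqVneq (f e) e0.
  apply: contra c0i => /eqP ->; apply/imsetP; exists e => //.
  by rewrite !inE eC fe eqxx.
by apply: Hc; rewrite !inE ?ee0 ?fe.
Qed.

(** * The joint law of the parent graph and its subsamples *)

Section CorrelatedGraphs.
Variables (R : realType) (n : nat) (p : 'I_n -> 'I_n -> R) (s : R).

(** A single probability attached to the unordered pair, which is well defined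
    by the symmetry of [p] ([edge_prob_set2]). *)
Definition edge_prob (e : {set 'I_n}) : R :=
  if [pick x : 'I_n * 'I_n | e == [set x.1; x.2]] is Some x then p x.1 x.2 else 0.

Definition keep_weight (b c : bool) : R :=
  if b then (if c then s else 1 - s) else (if c then 0 else 1).

Definition expect (F : sgraph n -> sgraph n -> sgraph n -> R) : R :=
  \sum_G \sum_G1 \sum_G2
    irg_law p G * subsample_law s G G1 * subsample_law s G G2 * F G G1 G2.

(** Expanding the product of the sums yields one term for each set of pairs,
    that is for each graph. *)
Lemma sum_sgraph_prod (phi : {set 'I_n} -> bool -> R) :
  \sum_(G : sgraph n) \prod_(e in vertex_pairs n) phi e (e \in edges G)
    = \prod_(e in vertex_pairs n) (phi e true + phi e false).
Proof.
rewrite [RHS]big_mkcond /=.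
transitivity (\prod_(e : {set 'I_n})
    ((if e \in vertex_pairs n then phi e true else 0)
     + (if e \in vertex_pairs n then phi e false else 1))); last first.
  by apply: eq_bigr => e _; case: ifP => // _; rewrite add0r.
rewrite bigA_distr (bigID (fun J : {set {set 'I_n}} => J \subset vertex_pairs n)) /=.
rewrite [X in _ + X]big1 ?addr0; last first.
  by move=> J /subsetPn[e eJ eE]; rewrite (bigD1 e) //= eJ (negPf eE) mul0r.
rewrite (eq_bigl (fun J => J \in [set edges G | G : sgraph n]%SET)); last first.
  move=> J; apply/idP/imsetP => [JE|[G _ ->]]; last exact: edges_vertex_pairs.
  have J2 : [forall e in J, #|e| == 2%N].
    by apply/forall_inP => e /(subsetP JE); rewrite inE.
  by exists (SGraph J2).
rewrite big_imset /=; last by move=> G G' _ _; exact: val_inj.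
apply: eq_bigr => G _; rewrite big_mkcond /=; apply: eq_bigr => e _.
have [eE|eE] := boolP (e \in vertex_pairs n); first by case: (e \in edges G).
have [eG|//] := boolP (e \in edges G).
by move: eE; rewrite (subsetP (edges_vertex_pairs G) e eG).
Qed.

Lemma subsample_lawE (G H : sgraph n) : subsample_law s G H =
  \prod_(e in vertex_pairs n) keep_weight (e \in edges G) (e \in edges H).
Proof.
rewrite /subsample_law; case: ifPn => [HG|/subsetPn[e eH eG]]; last first.
  by rewrite (bigD1 e) ?(subsetP (edges_vertex_pairs H)) //= (negPf eG) eH mul0r.
rewrite [RHS](big_setID (edges G)) /= (setIidPr (edges_vertex_pairs G)).
rewrite [X in _ = _ * X]big1 ?mulr1; last first.
  move=> e; rewrite inE => /andP[eG _]; rewrite (negPf eG) /keep_weight.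
  by have /negPf -> : e \notin edges H by apply: contra eG => /(subsetP HG).
by apply: eq_bigr => e eG; rewrite (eG : e \in edges G).
Qed.

Hypothesis hp : edge_probabilities p.
Hypothesis hs : 0 <= s <= 1.

Lemma edge_prob_set2 i j : edge_prob [set i; j] = p i j.
Proof.
have [_ psym _] := hp; rewrite /edge_prob; case: pickP => [[a b] /= /eqP E|].
  have := set21 i j; have := set22 i j; rewrite E !inE.
  have := set21 a b; have := set22 a b; rewrite -E !inE.
  by do 4!(case/orP => /eqP ?); subst.
by move/(_ (i, j)); rewrite /= eqxx.
Qed.

Lemma edge_prob01 e : 0 <= edge_prob e <= 1.
Proof.
have [p01 _ _] := hp; rewrite /edge_prob; case: pickP => [x _|_]; first exact: p01.
by rewrite lexx ler01.
Qed.

Lemma irg_lawE (G : sgraph n) : irg_law p G =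
  \prod_(e in vertex_pairs n) (if e \in edges G then edge_prob e else 1 - edge_prob e).
Proof.
pose h (x : 'I_n * 'I_n) := [set x.1; x.2].
have hinj : {in [pred x : 'I_n * 'I_n | (x.1 < x.2)%N] &, injective h}.
  move=> [i j] [a b]; rewrite !inE /h /= => ij ab E.
  have := set21 i j; have := set22 i j; rewrite E !inE.
  have := set21 a b; have := set22 a b; rewrite -E !inE.
  by do 4!(case/orP => /eqP ?); subst => //; lia.
rewrite /irg_law pair_big_dep /=.
rewrite (eq_bigl (mem [pred x : 'I_n * 'I_n | (x.1 < x.2)%N])) //=.
transitivity (\prod_(e in [set h x | x in [pred x : 'I_n * 'I_n | (x.1 < x.2)%N]]%SET)
    (if e \in edges G then edge_prob e else 1 - edge_prob e)).
  rewrite big_imset //=; apply: eq_bigr => -[i j] /= _.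
  by rewrite /h /= edge_prob_set2 /adj.
apply: eq_bigl => e; apply/imsetP/idP => [[[i j]]|].
  move=> /= ij ->; apply: (@set2_vertex_pairs n i j).
  by apply: contraTneq ij => ->; rewrite inE /= ltnn.
rewrite inE => /cards2P[a [b [ab ->]]].
have [lab|lba] := ltnP a b; first by exists (a, b).
exists (b, a); last by rewrite /h /= setUC.
by rewrite inE /= ltn_neqAle lba andbT eq_sym.
Qed.

Lemma keep_weight_ge0 b c : 0 <= keep_weight b c.
Proof. by have /andP[s0 s1] := hs; case: b; case: c; rewrite /keep_weight ?subr_ge0. Qed.

Lemma irg_law_ge0 (G : sgraph n) : 0 <= irg_law p G.
Proof.
rewrite irg_lawE prodr_ge0 // => e _; have /andP[p0 p1] := edge_prob01 e.
by case: ifP; rewrite ?subr_ge0.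
Qed.

Lemma subsample_law_ge0 (G H : sgraph n) : 0 <= subsample_law s G H.
Proof. by rewrite subsample_lawE prodr_ge0 // => e _; exact: keep_weight_ge0. Qed.

(** The product structure of the joint law: given the state of a pair in the
    parent graph, its states in the two subsamples are independent, and distinct
    pairs are independent. *)
Lemma expect_prod (phi : {set 'I_n} -> bool -> bool -> bool -> R) :
  expect (fun G G1 G2 => \prod_(e in vertex_pairs n)
            phi e (e \in edges G) (e \in edges G1) (e \in edges G2))
  = \prod_(e in vertex_pairs n)
     (edge_prob e * (s * (s * phi e true true true + (1 - s) * phi e true true false)
        + (1 - s) * (s * phi e true false true + (1 - s) * phi e true false false))
      + (1 - edge_prob e) * phi e false false false).
Proof.
pose Q e b b1 b2 := (if b then edge_prob e else 1 - edge_prob e)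
  * keep_weight b b1 * keep_weight b b2 * phi e b b1 b2.
pose Q1 e b b1 := Q e b b1 true + Q e b b1 false.
pose Q0 e b := Q1 e b true + Q1 e b false.
transitivity (\sum_G \sum_G1 \sum_G2 \prod_(e in vertex_pairs n)
    Q e (e \in edges G) (e \in edges G1) (e \in edges G2)).
  do 3!(apply: eq_bigr => ? _).
  by rewrite irg_lawE !subsample_lawE -!big_split.
transitivity (\sum_G \sum_G1 \prod_(e in vertex_pairs n)
    Q1 e (e \in edges G) (e \in edges G1)).
  apply: eq_bigr => G _; apply: eq_bigr => G1 _.
  exact: (sum_sgraph_prod (fun e => Q e (e \in edges G) (e \in edges G1))).
transitivity (\sum_G \prod_(e in vertex_pairs n) Q0 e (e \in edges G)).
  apply: eq_bigr => G _; exact: (sum_sgraph_prod (fun e => Q1 e (e \in edges G))).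
rewrite (sum_sgraph_prod Q0).
by apply: eq_bigr => e _; rewrite /Q0 /Q1 /Q /keep_weight; ring.
Qed.

Lemma eq_expect F F' : (forall G G1 G2, F G G1 G2 = F' G G1 G2) ->
  expect F = expect F'.
Proof. by move=> FF; do 3!(apply: eq_bigr => ? _); rewrite FF. Qed.

Lemma expectZ c F : expect (fun G G1 G2 => c * F G G1 G2) = c * expect F.
Proof.
rewrite /expect; do 3!(rewrite [RHS]mulr_sumr; apply: eq_bigr => ? _).
by rewrite mulrCA.
Qed.

Lemma expect_sum (I : finType) (P : pred I)
    (F : I -> sgraph n -> sgraph n -> sgraph n -> R) :
  expect (fun G G1 G2 => \sum_(i | P i) F i G G1 G2) = \sum_(i | P i) expect (F i).
Proof.
rewrite /expect [RHS]exchange_big; do 2!(apply: eq_bigr => ? _; rewrite [RHS]exchange_big).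
by apply: eq_bigr => ? _; rewrite mulr_sumr.
Qed.

(** Only subgraphs of the parent graph have positive weight, so the comparison
    may assume the inclusions. *)
Lemma le_expect F F' :
  (forall G G1 G2 : sgraph n, edges G1 \subset edges G -> edges G2 \subset edges G ->
     F G G1 G2 <= F' G G1 G2) ->
  expect F <= expect F'.
Proof.
move=> FF; apply: ler_sum => G _; apply: ler_sum => G1 _; apply: ler_sum => G2 _.
have [G1G|nG1] := boolP (edges G1 \subset edges G); last first.
  by rewrite /subsample_law (negPf nG1) mulr0 !mul0r.
have [G2G|nG2] := boolP (edges G2 \subset edges G); last first.
  by rewrite {2 4}/subsample_law (negPf nG2) mulr0 !mul0r.
by rewrite ler_wpM2l ?FF // !mulr_ge0 ?irg_law_ge0 ?subsample_law_ge0.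
Qed.

Lemma expect_cst c : expect (fun _ _ _ => c) = c.
Proof.
rewrite -[RHS]mulr1 -[X in expect X](_ : (fun _ _ _ => c * 1) = _); last first.
  by do 3!apply/funext => ?; rewrite mulr1.
rewrite expectZ; congr (_ * _).
transitivity (expect (fun G G1 G2 => \prod_(e in vertex_pairs n) (fun _ _ _ _ => 1)
   e (e \in edges G) (e \in edges G1) (e \in edges G2))).
  by apply: eq_expect => *; rewrite big1.
by rewrite (expect_prod (fun _ _ _ _ => 1)) big1 // => e _; ring.
Qed.

Lemma expect_subset (T : {set {set 'I_n}}) : T \subset vertex_pairs n ->
  expect (fun G _ _ => (T \subset edges G)%:R) = \prod_(e in T) edge_prob e.
Proof.
move=> TE; pose phi e b (_ _ : bool) : R := ((e \in T) ==> b)%:R.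
transitivity (expect (fun G G1 G2 => \prod_(e in vertex_pairs n)
   phi e (e \in edges G) (e \in edges G1) (e \in edges G2))).
  apply: eq_expect => G G1 G2; rewrite /phi /=.
  have [/subsetP TG|/subsetPn[e eT eG]] := boolP (T \subset edges G).
    by rewrite big1 // => e _; case: (boolP (e \in T)) => //= /TG ->.
  by rewrite (bigD1 e) ?(subsetP TE) //= eT (negPf eG) mul0r.
rewrite (expect_prod phi) /phi /= (big_setID T) /= (setIidPr TE).
rewrite [X in _ * X]big1 ?mulr1 => [|e]; last first.
  by rewrite inE => /andP[/negPf -> _] /=; ring.
by apply: eq_bigr => e eT; rewrite (eT : e \in T) /=; ring.
Qed.

Lemma expect_exp_half_common (T : {set {set 'I_n}}) : T \subset vertex_pairs n ->
  expect (fun _ G1 G2 => 2^-1 ^+ #|edges G1 :&: edges G2 :&: T|%SET)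
  = \prod_(e in T) (1 - edge_prob e * s ^+ 2 / 2).
Proof.
move=> TE; pose phi e (_ b1 b2 : bool) : R := if [&& b1, b2 & e \in T] then 2^-1 else 1.
transitivity (expect (fun G G1 G2 => \prod_(e in vertex_pairs n)
   phi e (e \in edges G) (e \in edges G1) (e \in edges G2))).
  apply: eq_expect => G G1 G2; rewrite /phi /=  -prodr_const.
  rewrite [RHS]big_mkcond [LHS]big_mkcond; apply: eq_bigr => e _ /=.
  rewrite !in_setI -andbA; case: ifPn => [/and3P[_ _ eT]|]; last by rewrite if_same.
  by rewrite (subsetP TE).
rewrite (expect_prod phi) /phi /= (big_setID T) /= (setIidPr TE).
rewrite [X in _ * X]big1 ?mulr1 => [|e]; last first.
  by rewrite inE => /andP[/negPf -> _] /=; ring.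
by apply: eq_bigr => e eT; rewrite (eT : e \in T) /=; field.
Qed.

Lemma corr_probE (A : sgraph n -> sgraph n -> 'S_n -> bool) :
  corr_prob p s A = expect (fun _ G1 G2 =>
     \sum_(pi : 'S_n) (n`!%:R)^-1 * (A G1 (relabel pi G2) pi)%:R).
Proof.
rewrite /expect !pair_bigA /=; under eq_bigr do rewrite mulr_sumr.
rewrite pair_bigA /corr_prob big_mkcond. apply: eq_bigr => -[[[G G1] G2] pi] _ /=.
by rewrite mulrA; case: ifP => _; rewrite ?mulr1 ?mulr0.
Qed.

Lemma sum_uniform_perm : \sum_(pi : 'S_n) (n`!%:R : R)^-1 = 1.
Proof.
by rewrite sumr_const card_Sn -[LHS]mulr_natr mulVf // pnatr_eq0 -lt0n fact_gt0.
Qed.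

Lemma corr_prob_le1 (A : sgraph n -> sgraph n -> 'S_n -> bool) : corr_prob p s A <= 1.
Proof.
rewrite corr_probE -[leRHS](expect_cst 1); apply: le_expect => G G1 G2 _ _.
rewrite -[leRHS]sum_uniform_perm; apply: ler_sum => pi _.
by rewrite ler_piMr ?invr_ge0 ?ler0n // lern1 leq_b1.
Qed.

(** A union bound: [B1] and [B2] count occurrences of two bad events, and the
    event fails only if one of them occurs. *)
Lemma corr_prob_ge (A : sgraph n -> sgraph n -> 'S_n -> bool)
    (B1 B2 : sgraph n -> sgraph n -> sgraph n -> R) :
  (forall G G1 G2, 0 <= B1 G G1 G2) -> (forall G G1 G2, 0 <= B2 G G1 G2) ->
  (forall G G1 G2 pi, edges G1 \subset edges G -> edges G2 \subset edges G ->
     ~~ A G1 (relabel pi G2) pi -> 1 <= B1 G G1 G2 + B2 G G1 G2) ->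
  1 - (expect B1 + expect B2) <= corr_prob p s A.
Proof.
move=> B10 B20 AB; rewrite corr_probE lerBlDr.
have expD F F' : expect F + expect F' = expect (fun G G1 G2 => F G G1 G2 + F' G G1 G2).
  by rewrite /expect -big_split; do 2!(apply: eq_bigr => ? _; rewrite -big_split);
     apply: eq_bigr => ? _; rewrite /= -mulrDr.
rewrite !expD -[leLHS](expect_cst 1); apply: le_expect => G G1 G2 G1G G2G.
rewrite -[leLHS]sum_uniform_perm -[X in _ <= _ + X]mul1r.
rewrite -[X in _ <= _ + X * _]sum_uniform_perm mulr_suml -big_split /=.
apply: ler_sum => pi _; rewrite -mulrDr ler_peMr ?invr_ge0 ?ler0n //.
have [_|nA] := boolP (A _ _ _); first by rewrite lerDl addr_ge0.
by rewrite add0r (AB _ _ _ pi).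
Qed.

End CorrelatedGraphs.

(** * Few removed vertices in the peeling *)

Section Bounds.
Variable R : realType.

(** The weak form of the Stirling lower bound, from [(1 + 1/m) ^ m <= e]. *)
Lemma exprnn_le_fact m : m%:R ^+ m <= expR m%:R * (m`!)%:R :> R.
Proof.
elim: m => [|m IH]; first by rewrite expr0 expR0 fact0 mulr1.
have e0 := expR_ge0 (1 : R).
rewrite exprS factS natrM mulrCA ler_wpM2l ?ler0n //.
case: m IH => [_|m IH]; first by rewrite expr0 fact0 mulr1 -[leLHS]expR0 ler_expR.
have -> : expR m.+2%:R = expR m.+1%:R * expR 1 :> R by rewrite -expRD natr1.
rewrite mulrAC; apply: le_trans (ler_wpM2r e0 IH).
have m0 : 0 < m.+1%:R :> R by rewrite ltr0n.
have -> : m.+2%:R = m.+1%:R * (1 + m.+1%:R^-1) :> R.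
  by rewrite mulrDr mulr1 divff ?gt_eqF // natr1.
rewrite exprMn ler_wpM2l ?exprn_ge0 ?ler0n //.
rewrite -[X in expR X](@divff _ (m.+1%:R : R)) ?gt_eqF // mulrC expRM_natr.
by rewrite lerXn2r ?nnegrE ?expR_ge0 ?expR_ge1Dx // addr_ge0 // invr_ge0 ler0n.
Qed.

Lemma bin_le n m : ('C(n, m))%:R * m%:R ^+ m <= (expR 1 * n%:R) ^+ m :> R.
Proof.
rewrite exprMn -expRM_natr mul1r; apply: le_trans (ler_wpM2l (ler0n _ _) (exprnn_le_fact m)) _.
rewrite mulrCA ler_wpM2l ?expR_ge0 // -natrM bin_ffact -natrX ler_nat.
elim: m => // m IH; rewrite ffactnSr expnSr leq_mul //; exact: leq_subr.
Qed.

End Bounds.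

Section CoreSize.
Variables (R : realType) (n : nat) (p : 'I_n -> 'I_n -> R) (s : R).
Hypothesis hp : edge_probabilities p.
Hypothesis hs : 0 <= s <= 1.

(** Each pair touching [S] has at most two endpoints in [S]; whence the factor
    2 between the sum of the degrees and the number of edges. *)
Lemma touching_mean (S : {set 'I_n}) (lam : R) :
  (forall i, lam <= \sum_j p i j * s ^+ 2) ->
  #|S|%:R * lam <= 2 * \sum_(e in vertex_pairs n :&: touching S) edge_prob p e * s ^+ 2.
Proof.
move=> hlam; have [_ _ pii] := hp; have /andP[s0 _] := hs.
pose f e := edge_prob p e * s ^+ 2.
have f0 e : 0 <= f e by rewrite mulr_ge0 ?exprn_ge0 //; case/andP: (edge_prob01 hp e).
apply: (@le_trans _ _ (\sum_(i in S) \sum_(j | j != i) f [set i; j])).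
  rewrite mulr_natl -sumr_const; apply: ler_sum => i _.
  apply: le_trans (hlam i) _; rewrite (bigD1 i) //= pii mul0r add0r.
  by apply: ler_sum => j _; rewrite /f edge_prob_set2.
rewrite sum_incident mulr_sumr (big_setID (touching S)) /= [X in _ + X]big1 ?addr0.
  apply: ler_sum => e; rewrite !inE => /andP[/eqP e2 _].
  by rewrite -[leLHS]mulr_natl ler_wpM2r ?f0 // ler_nat -e2 subset_leq_card // subsetIl.
move=> e; rewrite !inE negbK => /andP[/eqP -> _]; by rewrite cards0.
Qed.

(** A Chernoff bound with base 1/2: the moment [E 2^-N] of the number [N] of
    common edges touching [S] is a product of factors [1 - r / 2 <= exp (- r / 2)],
    with [r] the probability of a common edge. *)
Lemma prob_few_touching_le (S : {set 'I_n}) (lam : R) (m : nat) :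
  (forall i, lam <= \sum_j p i j * s ^+ 2) ->
  expect p s (fun _ G1 G2 =>
      (#|edges G1 :&: edges G2 :&: touching S|%SET <= m)%N%:R)
    <= 2 ^+ m * expR (- (#|S|%:R * lam / 4)).
Proof.
move=> hlam; set T := (vertex_pairs n :&: touching S)%SET.
apply: (@le_trans _ _ (2 ^+ m * expect p s (fun _ G1 G2 =>
    2^-1 ^+ #|edges G1 :&: edges G2 :&: T|%SET))).
  rewrite -expectZ; apply: le_expect => // G G1 G2 _ _.
  have -> : (edges G1 :&: edges G2 :&: T = edges G1 :&: edges G2 :&: touching S)%SET.
    rewrite /T setIA; congr (_ :&: _)%SET; apply/setIidPl.
    exact: subset_trans (subsetIl _ _) (edges_vertex_pairs _).
  case: leqP => [le_m|_]; last by rewrite mulr_ge0 ?exprn_ge0 // ?invr_ge0 ler0n.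
  rewrite -(subnK le_m) exprD -mulrA -exprMn divff ?pnatr_eq0 // expr1n mulr1.
  by rewrite exprn_ege1 // ler1n.
rewrite ler_wpM2l ?exprn_ge0 ?ler0n // expect_exp_half_common ?subsetIl //.
apply: (@le_trans _ _ (\prod_(e in T) expR (- (edge_prob p e * s ^+ 2 / 2)))).
  apply: ler_prod => e _; rewrite expR_ge1Dx andbT.
  have /andP[e0 e1] := edge_prob01 hp e; have /andP[s0 s1] := hs.
  have : edge_prob p e * s ^+ 2 <= 1 by rewrite mulr_ile1 ?exprn_ge0 ?exprn_ile1.
  by lra.
rewrite -expR_sum ler_expR sumrN lerN2 -mulr_suml.
by have := touching_mean S hlam; rewrite -/T; lra.
Qed.

Lemma expect_few_touching_sets_le (x m : nat) (lam : R) :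
  (forall i, lam <= \sum_j p i j * s ^+ 2) ->
  expect p s (fun _ G1 G2 => \sum_(S : {set 'I_n} | #|S| == x)
      (#|edges G1 :&: edges G2 :&: touching S|%SET <= m)%N%:R)
    <= 'C(n, x)%:R * (2 ^+ m * expR (- (x%:R * lam / 4))).
Proof.
move=> hlam; rewrite (expect_sum p s (fun S : {set 'I_n} => #|S| == x)
   (fun S _ G1 G2 => (#|edges G1 :&: edges G2 :&: touching S|%SET <= m)%N%:R)).
have := card_draws 'I_n x; rewrite card_ord => <-; rewrite mulr_natl -sumr_const.
rewrite [leRHS](eq_bigl (fun S : {set 'I_n} => #|S| == x)) => [|S]; last by rewrite inE.
by apply: ler_sum => S /eqP <-; exact: prob_few_touching_le.
Qed.

End CoreSize.

(** The constants of the theorem meet here.  The number of sets is at most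
    [(e n / x)^x <= (4 / 3 * exp (lam / 7))^x], and [lam >= 154] makes
    [exp (- 3 lam / 28)] smaller than [2^-14], against the loss [2^12]. *)
Lemma core_union_term_le (R : realType) (n x : nat) (lam : R) : (0 < x)%N ->
  154 <= lam -> 3 * expR (- (lam / 7)) * n%:R <= x%:R ->
  'C(n, x)%:R * (2 ^+ (12 * x) * expR (- (x%:R * lam / 4))) <= 2^-1 ^+ x.
Proof.
move=> x0 lam154 nx; have x0R : 0 < x%:R :> R by rewrite ltr0n.
have xx0 : 0 < x%:R ^+ x :> R by rewrite exprn_gt0.
rewrite -(ler_pM2r xx0) mulrAC.
have := bin_le R n x => Cle.
apply: le_trans (ler_wpM2r _ Cle) _.
  by rewrite mulr_ge0 ?expR_ge0 ?exprn_ge0.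
have -> : - (x%:R * lam / 4) = - (lam / 4) * x%:R by ring.
rewrite expRM_natr exprM -!exprMn.
rewrite lerXn2r ?nnegrE ?mulr_ge0 ?expR_ge0 ?ler0n ?invr_ge0 ?exprn_ge0 //.
have e4 : expR 1 <= 4 :> R.
  have h2 : expR (2^-1) <= 2 :> R.
    rewrite -[leLHS]invrK -expRN -[leRHS]invrK lef_pV2 ?posrE ?expR_gt0 ?invr_gt0 //.
    by apply: le_trans (expR_ge1Dx _); lra.
  rewrite -[X in expR X](_ : 2^-1 * 2%:R = 1 :> R); last by rewrite mulVf.
  rewrite expRM_natr (_ : 4 = 2 ^+ 2); last by rewrite expr2; lra.
  by rewrite lerXn2r ?nnegrE ?expR_ge0.
have E : expR (- (lam / 4)) <= expR (- (lam / 7)) * (2 ^+ 14)^-1.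
  have -> : - (lam / 4) = - (lam / 7) + - (3 * lam / 28) by lra.
  rewrite expRD ler_wpM2l ?expR_ge0 // expRN lef_pV2 ?posrE ?expR_gt0 ?exprn_gt0 //.
  apply: (@le_trans _ _ (expR (1 * 14%:R))); last by rewrite ler_expR; lra.
  rewrite expRM_natr lerXn2r ?nnegrE ?expR_ge0 //.
  by apply: le_trans (expR_ge1Dx _).
apply: (@le_trans _ _ (4 * n%:R * (2 ^+ 12 * (expR (- (lam / 7)) * (2 ^+ 14)^-1)))).
  apply: ler_pM; rewrite ?mulr_ge0 ?expR_ge0 ?ler0n ?exprn_ge0 //.
    by rewrite ler_wpM2r ?ler0n.
  by rewrite ler_wpM2l ?exprn_ge0.
have -> : 4 * n%:R * (2 ^+ 12 * (expR (- (lam / 7)) * (2 ^+ 14)^-1)) =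
  3 * expR (- (lam / 7)) * n%:R * 3^-1 :> R.
  rewrite (exprD 2 12 2) expr2; have : (2 : R) ^+ 12 != 0 by rewrite expf_neq0.
  by move: (2 ^+ 12) => c c0; field.
rewrite mulrC; apply: ler_pM; rewrite ?mulr_ge0 ?expR_ge0 // lef_pV2 ?posrE //; lra.
Qed.

(** * Overlap of the parent graph with its image under a partial map *)

Section Overlap.
Variables (R : realType) (n : nat) (p : 'I_n -> 'I_n -> R) (s q : R).
Hypothesis hp : edge_probabilities p.
Hypothesis hs : 0 <= s <= 1.
Hypothesis pq : forall i j, p i j <= q.

Lemma edge_prob_le (e : {set 'I_n}) : e \in vertex_pairs n -> edge_prob p e <= q.
Proof. by rewrite inE => /cards2P[i [j [_ ->]]]; rewrite edge_prob_set2. Qed.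

(** When the couples [(e, f e)], for [e] in [A], are pairwise disjoint, both pairs
    of a couple are edges with probability at most [q ^+ 2], independently for
    distinct [e].  Expanding the product over the subsets [J] of [A] reduces the
    claim to the probability that all the pairs of [J] and [f @: J] are edges. *)
Lemma expect_exp_le (A : {set {set 'I_n}}) (f : {set 'I_n} -> {set 'I_n})
    (a : {set 'I_n} -> R) :
  A \subset vertex_pairs n -> {in A &, injective f} ->
  (forall e, e \in A -> f e \in vertex_pairs n) -> (forall e, e \in A -> f e \notin A) ->
  (forall e, 0 <= a e) ->
  expect p s (fun G _ _ =>
      \prod_(e in A) (1 + a e * ((e \in edges G) && (f e \in edges G))%:R))
    <= expR (q ^+ 2 * \sum_(e in A) a e).
Proof.
move=> AE finj fE fA a0.
(* Extending the weights by 0 lets the expansion run over all sets of pairs. *)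
pose b e := if e \in A then a e else 0.
have b0 e : 0 <= b e by rewrite /b; case: ifP.
pose X (G : sgraph n) e : R := ((e \in edges G) && (f e \in edges G))%:R.
have E1 (G : sgraph n) : \prod_(e in A) (1 + a e * X G e) =
    \sum_(J : {set {set 'I_n}}) \prod_(e in J) b e * \prod_(e in J) X G e.
  rewrite big_mkcond /= (eq_bigr (fun e => b e * X G e + 1)) => [|e _]; last first.
    by rewrite /b; case: ifP => _; rewrite ?mul0r ?add0r // addrC.
  rewrite bigA_distr; apply: eq_bigr => J _.
  by rewrite -big_split [RHS]big_mkcond.
rewrite (eq_expect p s (F' := fun G _ _ =>
  \sum_(J : {set {set 'I_n}}) \prod_(e in J) b e * \prod_(e in J) X G e));
  last by move=> G _ _; exact: E1.
rewrite (expect_sum p s predT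
  (fun (J : {set {set 'I_n}}) G _ _ => \prod_(e in J) b e * \prod_(e in J) X G e)).
apply: (@le_trans _ _ (\sum_(J : {set {set 'I_n}}) \prod_(e in J) (b e * q ^+ 2))).
  apply: ler_sum => J _; rewrite expectZ big_split /=.
  have [JA|/subsetPn[e eJ eA]] := boolP (J \subset A); last first.
    by rewrite (bigD1 e) //= {1 3}/b (negPf eA) !mul0r.
  rewrite ler_wpM2l ?prodr_ge0 //.
  have JA' e : e \in J -> e \in A := subsetP JA e.
  pose T := J :|: f @: J.
  have TE : T \subset vertex_pairs n.
    apply/subsetP => e; rewrite !inE => /orP[/JA'/(subsetP AE)|/imsetP[d /JA' dA ->]].
      by rewrite inE.
    by have := fE _ dA; rewrite inE.
  rewrite (_ : expect p s _ = expect p s (fun G _ _ => (T \subset edges G)%:R)).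
    rewrite expect_subset // prodr_const -exprM mulnC.
    have -> : (#|J| * 2)%N = #|T|.
      rewrite cardsU card_in_imset; last by move=> d e /JA' dA /JA' eA; apply: finj.
      rewrite (_ : J :&: f @: J = set0) ?cards0 ?muln2 ?addnn ?subn0 //.
      apply/setP => e; rewrite !inE; apply/negP => /andP[/JA' eA /imsetP[d /JA' dA Ed]].
      by have := fA _ dA; rewrite -Ed eA.
    rewrite -prodr_const; apply: ler_prod => e /(subsetP TE) eE.
    by rewrite edge_prob_le // andbT; case/andP: (edge_prob01 hp e).
  apply: eq_expect => G _ _; rewrite /X.
  have [/subsetP TG|/subsetPn[e eT eG]] := boolP (T \subset edges G).
    rewrite big1 // => e eJ; rewrite !TG // in_setU ?eJ //.
    by rewrite imset_f ?orbT.
  move: eT; rewrite in_setU => /orP[eJ|/imsetP[d dJ Ed]].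
    by rewrite (bigD1 e) //= (negPf eG) mul0r.
  by rewrite (bigD1 d) //= -Ed (negPf eG) andbF mul0r.
rewrite (_ : \sum_J _ = \prod_e (b e * q ^+ 2 + 1)); last first.
  by rewrite bigA_distr; apply: eq_bigr => J _; rewrite big_mkcond.
apply: (@le_trans _ _ (\prod_e expR (q ^+ 2 * b e))).
  apply: ler_prod => e _; apply/andP; split.
    by apply: addr_ge0 => //; apply: mulr_ge0 => //; exact: sqr_ge0.
  by rewrite addrC [b e * _]mulrC expR_ge1Dx.
rewrite -expR_sum -mulr_sumr ler_expR [in leRHS]big_mkcond /=.
by rewrite (eq_bigr b).
Qed.

Variable g : {ffun 'I_n -> 'I_n}.

Definition moved : {set 'I_n} := [set i | g i != i].

(** The largest set containing [moved] on which [g] remains injective.  A fixed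
    point hit by a moved vertex is left out. *)
Definition overlap_dom : {set 'I_n} := [set i | (i \in moved) || (i \notin g @: moved)].

Definition overlap (G : sgraph n) : nat :=
  (\sum_(i in moved) #|[set j in overlap_dom |
     ([set i; j] \in edges G) && ([set g i; g j] \in edges G)]|)%N.

Definition shifted_pairs : {set {set 'I_n}} :=
  [set e in vertex_pairs n | [&& e \subset overlap_dom, e :&: moved != set0 & g @: e != e]].

Definition doubled (G : sgraph n) (e : {set 'I_n}) : bool :=
  (e \in edges G) && (g @: e \in edges G).

Hypothesis ginj : {in moved &, injective g}.

Lemma overlap_dom_inj : {in overlap_dom &, injective g}.
Proof.
have key i j : i \in moved -> j \notin moved -> j \in overlap_dom -> g i <> g j.
  rewrite inE => im; rewrite !inE => jm; rewrite (negPf jm) /= => /negP jg gij.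
  apply: jg; apply/imsetP; exists i; first by rewrite inE.
  by rewrite gij; apply/esym/eqP/negPn.
move=> i j iD jD gij.
have [im|im] := boolP (i \in moved); have [jm|jm] := boolP (j \in moved).
- exact: ginj.
- by case: (key i j).
- by case: (key j i).
- by move: im jm gij; rewrite !inE !negbK => /eqP -> /eqP ->.
Qed.

(** A moved vertex [i] lies in only one pair fixed by [g], namely [{i, g i}], so
    the fixed pairs contribute at most one incidence for each moved vertex. *)
Lemma overlap_le (G : sgraph n) :
  (overlap G)%:R <= #|moved|%:R
     + \sum_(e in shifted_pairs) (#|e :&: moved| * doubled G e)%N%:R :> R.
Proof.
pose f (e : {set 'I_n}) : R := ((e \subset overlap_dom) && doubled G e)%:R.
have -> : (overlap G)%:R = \sum_(i in moved) \sum_(j | j != i) f [set i; j].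
  rewrite /overlap natr_sum; apply: eq_bigr => i im.
  rewrite -sum1_card natr_sum big_mkcond [RHS]big_mkcond /=.
  apply: eq_bigr => j _; rewrite in_set /f subUset !sub1set /doubled imsetU !imset_set1.
  have iD : i \in overlap_dom by rewrite inE im.
  rewrite iD /=; have [->|_] := eqVneq j i.
    have : [set i; i] \notin edges G.
      by apply/negP => /(subsetP (edges_vertex_pairs G)); rewrite inE setUid cards1.
    by move=> /negPf ->; rewrite andbF.
  by case: (_ && _).
pose f1 (e : {set 'I_n}) : R := if g @: e == e then f e else 0.
pose f2 (e : {set 'I_n}) : R := if g @: e == e then 0 else f e.
have -> : \sum_(i in moved) \sum_(j | j != i) f [set i; j] =
    \sum_(i in moved) \sum_(j | j != i) f1 [set i; j] +
    \sum_(i in moved) \sum_(j | j != i) f2 [set i; j].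
  rewrite -big_split; apply: eq_bigr => i _; rewrite -big_split; apply: eq_bigr => j _.
  by rewrite /f1 /f2 /=; case: ifP => _; rewrite ?addr0 ?add0r.
apply: lerD.
  rewrite -sumr_const; apply: ler_sum => i; rewrite inE => im.
  have f1_0 j : j != i -> j != g i -> f1 [set i; j] = 0.
    move=> ji jg; rewrite /f1; case: eqP => // /setP /(_ (g i)).
    by rewrite imsetU !imset_set1 !inE eqxx (negPf im) (eq_sym (g i) j) (negPf jg).
  rewrite (bigD1 (g i)) //= big1 ?addr0 => [|j /andP[]]; last exact: f1_0.
  by rewrite /f1 /f; case: ifP => _ //; rewrite lern1 leq_b1.
rewrite sum_incident (big_setID shifted_pairs) /= (setIidPr _); last first.
  by apply/subsetP => e; rewrite !inE => /andP[].
rewrite [X in _ + X]big1 ?addr0 => [|e]; last first.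
  rewrite in_setD => /andP[eS eE]; rewrite /f2 /f; case: eqP => [_|/eqP ge].
    by rewrite mul0rn.
  have [eD|_] := boolP (e \subset overlap_dom); last by rewrite mul0rn.
  have [->|em] := eqVneq (e :&: moved) set0; first by rewrite cards0.
  by move: eS; rewrite inE eE eD em ge.
apply: ler_sum => e; rewrite inE => /and4P[_ eD _ ge].
by rewrite /f2 /f (negPf ge) eD /= natrM mulr_natl.
Qed.

(** A moved vertex has at most [#|moved|] moved partners, in pairs of weight
    [z ^+ 2], and at most [n] other ones, in pairs of weight [z]. *)
Lemma overlap_class_mean (z : R) : 1 <= z ->
  \sum_(e in shifted_pairs) (z ^+ #|e :&: moved| - 1)
    <= #|moved|%:R * (n%:R * z + #|moved|%:R * z ^+ 2).
Proof.
move=> z1; have z0 : 0 <= z by apply: le_trans z1.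
pose f (e : {set 'I_n}) := z ^+ #|e :&: moved|.
apply: (@le_trans _ _ (\sum_(e in vertex_pairs n) f e *+ #|e :&: moved|)).
  rewrite [leRHS](big_setID shifted_pairs) /= (setIidPr _); last first.
    by apply/subsetP => e; rewrite !inE => /andP[].
  rewrite -[leLHS]addr0; apply: lerD; last first.
    by apply: sumr_ge0 => e _; rewrite mulrn_wge0 // exprn_ge0.
  apply: ler_sum => e; rewrite inE => /and4P[_ _ em _].
  move: em; rewrite -cards_eq0 -lt0n => em.
  apply: (@le_trans _ _ (f e)); first by rewrite /f lerBlDr lerDl.
  by rewrite -[leRHS]mulr_natl ler_peMl ?exprn_ge0 // ler1n.
rewrite -sum_incident mulr_natl -sumr_const; apply: ler_sum => i im.
apply: (@le_trans _ _ (\sum_j (z + (if j \in moved then z ^+ 2 else 0)))).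
  rewrite big_mkcond; apply: ler_sum => j _.
  have zz0 : 0 <= z ^+ 2 by rewrite exprn_ge0.
  case: ifP => ji; last by rewrite addr_ge0 //; case: ifP.
  rewrite /f setIUl cardsU.
  case: ifPn => jm.
    apply: (@le_trans _ _ (z ^+ 2)); last by rewrite lerDr.
    rewrite ler_weXn2l // (leq_trans (leq_subr _ _)) // (@leq_add _ _ 1 1) //.
      by rewrite -(cards1 i) subset_leq_card // subsetIl.
    by rewrite -(cards1 j) subset_leq_card // subsetIl.
  rewrite (_ : [set j] :&: moved = set0); last first.
    apply/setP => k; rewrite !inE; apply/negP => /andP[/eqP ->].
    by move: jm; rewrite !inE => /negP.
  rewrite cards0 addn0 addr0 -[leRHS]expr1 ler_weXn2l //.
  by rewrite (leq_trans (leq_subr _ _)) // -(cards1 i) subset_leq_card // subsetIl.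
rewrite big_split /= sumr_const card_ord -big_mkcond sumr_const.
by rewrite !mulr_natl.
Qed.

(** Of the 13 incidences for each moved vertex, 12 come from shifted pairs, so one
    of the three colour classes has 4 for each moved vertex.  Markov's inequality
    is applied to [z] to the power of the number of incidences in that class. *)
Lemma overlap_tail (z : R) : 1 <= z ->
  expect p s (fun G _ _ => (13 * #|moved| <= overlap G)%N%:R)
    <= 3 * (z ^- (4 * #|moved|)
        * expR (q ^+ 2 * (#|moved|%:R * (n%:R * z + #|moved|%:R * z ^+ 2)))).
Proof.
move=> z1; have z0 : 0 < z by apply: lt_le_trans z1.
have sub e : e \in shifted_pairs -> e \subset overlap_dom by rewrite inE => /and4P[].
have sE e : e \in shifted_pairs -> e \in vertex_pairs n by rewrite inE => /and4P[].
have imI : {in shifted_pairs &, injective (fun e : {set 'I_n} => g @: e)}.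
  move=> e e' /sub/subsetP eS /sub/subsetP e'S ee'; apply/setP => i.
  apply/idP/idP => ie; have := imset_f g ie.
    rewrite ee' => /imsetP[j je' gij].
    by rewrite (overlap_dom_inj (eS _ ie) (e'S _ je') gij).
  rewrite -ee' => /imsetP[j je' gij].
  by rewrite (overlap_dom_inj (e'S _ ie) (eS _ je') gij).
have [c Hc] : exists c : {set 'I_n} -> 'I_3, forall e, e \in shifted_pairs ->
    g @: e \in shifted_pairs -> c (g @: e) != c e.
  by apply: three_coloring imI _ => e; rewrite inE => /and4P[].
(* In a colour class no pair is the image of another one. *)
pose C k := [set e in shifted_pairs | c e == k].
pose Y k (G : sgraph n) := (\sum_(e in C k) #|e :&: moved| * doubled G e)%N.
have CS k : {subset C k <= shifted_pairs} by move=> e; rewrite inE => /andP[].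
apply: (@le_trans _ _ (expect p s (fun G _ _ =>
    \sum_(k : 'I_3) z ^- (4 * #|moved|) * z ^+ Y k G))).
  apply: le_expect => // G _ _ _ _.
  case: leqP => [ov|_]; last first.
    by apply: sumr_ge0 => k _; rewrite mulr_ge0 ?invr_ge0 // exprn_ge0 ?(ltW z0).
  (* Otherwise the three classes total less than [12 * #|moved|]. *)
  have [k Yk] : exists k, (4 * #|moved| <= Y k G)%N.
    apply/existsP; apply: contraTT ov; rewrite negb_exists => /forallP Ylt.
    rewrite -ltnNge -(ltr_nat R); apply: le_lt_trans (overlap_le G) _.
    have -> : \sum_(e in shifted_pairs) (#|e :&: moved| * doubled G e)%N%:R
        = (\sum_(k : 'I_3) Y k G)%N%:R :> R.
      rewrite -natr_sum (partition_big c predT) //=; congr (_%:R).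
      by apply: eq_bigr => k _; apply: eq_bigl => e; rewrite [in RHS]inE.
    rewrite -natrD ltr_nat !big_ord_recl big_ord0.
    by have := Ylt ord0; have := Ylt (lift ord0 ord0);
       have := Ylt (lift ord0 (lift ord0 ord0)); lia.
  rewrite (bigD1 k) //= -[leLHS]addr0; apply: lerD; last first.
    by apply: sumr_ge0 => k' _; rewrite mulr_ge0 ?invr_ge0 // exprn_ge0 ?(ltW z0).
  by rewrite ler_pdivlMl ?exprn_gt0 // mulr1 ler_weXn2l.
rewrite (expect_sum p s predT (fun k G _ _ => z ^- (4 * #|moved|) * z ^+ Y k G)).
rewrite mulr_natl -[X in _ *+ X](card_ord 3) -sumr_const; apply: ler_sum => k _.
rewrite expectZ ler_wpM2l ?invr_ge0 ?exprn_ge0 ?(ltW z0) //.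
pose a (e : {set 'I_n}) := z ^+ #|e :&: moved| - 1.
have a0 e : 0 <= a e by rewrite subr_ge0 exprn_ege1.
rewrite (_ : expect p s _ = expect p s (fun G _ _ =>
  \prod_(e in C k) (1 + a e * ((e \in edges G) && (g @: e \in edges G))%:R))); last first.
  apply: eq_expect => G _ _; rewrite /Y expr_sum; apply: eq_bigr => e _.
  rewrite /a /doubled; case: (_ && _); last by rewrite muln0 expr0 mulr0 addr0.
  by rewrite muln1 mulr1 addrC subrK.
apply: le_trans (expect_exp_le _ _ _ _ a0) _.
- by apply/subsetP => e /CS /sE.
- by move=> e e' /CS eS /CS e'S; apply: imI.
- move=> e /CS eS; rewrite inE card_in_imset; first by have := sE _ eS; rewrite inE.
  by move=> i j ie je; apply: overlap_dom_inj; apply: (subsetP (sub _ eS)).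
- move=> e eC; apply/negP => geC; have := Hc _ (CS _ _ eC) (CS _ _ geC).
  by move: eC geC; rewrite !inE => /andP[_ /eqP ->] /andP[_ ->].
rewrite ler_expR ler_wpM2l ?sqr_ge0 //; apply: le_trans (overlap_class_mean z1).
rewrite [leRHS](big_setID (C k)) /= (setIidPr _); last exact/subsetP/CS.
by rewrite lerDl sumr_ge0 // => e _; exact: a0.
Qed.

End Overlap.

(** * Union bounds *)

Section Numeric.
Variables (R : realType).

(** With [z] chosen so that [z ^+ 2 * d * n ^+ 2 * q ^+ 4 = 1], both terms of the
    exponent are at most [d], and [z ^- (4 * d)] is
    [(d ^+ 2 * n ^+ 4 * q ^+ 8) ^+ d].  One factor [d ^+ d] is absorbed by the
    binomial coefficient; keeping it is essential when [d] is of order [n]. *)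
Lemma overlap_union_term_le (n d : nat) (q z : R) : (0 < d <= n)%N -> 0 < q ->
  1 <= n%:R * q -> z = (Num.sqrt d%:R * (n%:R * q ^+ 2))^-1 ->
  'C(n, d)%:R * (n%:R ^+ d * (3 * (z ^- (4 * d)
     * expR (q ^+ 2 * (d%:R * (n%:R * z + d%:R * z ^+ 2))))))
  <= 3 * (expR 3 * (n%:R ^+ 7 * q ^+ 8)) ^+ d.
Proof.
move=> /andP[d0 dn] q0 nq1 zE.
have d0R : 0 < d%:R :> R by rewrite ltr0n.
have n0 : 0 < n%:R :> R by rewrite ltr0n (leq_trans d0).
have r0 : 0 < Num.sqrt d%:R :> R by rewrite sqrtr_gt0.
have rr : Num.sqrt d%:R ^+ 2 = d%:R :> R by rewrite sqr_sqrtr // ltW.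
set r := Num.sqrt _ in r0 rr zE.
have zV : z ^- (4 * d) = (d%:R ^+ 2 * n%:R ^+ 4 * q ^+ 8) ^+ d.
  rewrite zE exprVn invrK exprM; congr (_ ^+ d); rewrite -rr; ring.
have r1 : 1 <= r.
  by rewrite /r -[leLHS]sqrtr1 ler_sqrt // ler1n.
have expo : q ^+ 2 * (d%:R * (n%:R * z + d%:R * z ^+ 2)) <= 2 * d%:R.
  have -> : q ^+ 2 * (d%:R * (n%:R * z + d%:R * z ^+ 2))
      = d%:R * (r^-1 + (n%:R * q)^-1 ^+ 2).
    rewrite zE -{2}rr; field; rewrite !gt_eqF //.
  rewrite [leRHS]mulrC ler_pM2l //.
  have : r^-1 <= 1 by rewrite invf_le1.
  have : (n%:R * q)^-1 ^+ 2 <= 1.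
    have nq0 : 0 < n%:R * q by rewrite mulr_gt0.
    by rewrite exprn_ile1 ?invf_le1 // invr_ge0 ltW.
  lra.
rewrite zV; rewrite -ler_expR in expo; rewrite expRM_natr in expo.
have P0 : 0 <= d%:R ^+ 2 * n%:R ^+ 4 * q ^+ 8 by rewrite !mulr_ge0 ?exprn_ge0 ?ltW.
apply: (@le_trans _ _ ('C(n, d)%:R * (n%:R ^+ d
    * (3 * ((d%:R ^+ 2 * n%:R ^+ 4 * q ^+ 8) ^+ d * expR 2 ^+ d))))).
  rewrite !ler_wpM2l ?exprn_ge0 ?ler0n //.
have -> : 'C(n, d)%:R * (n%:R ^+ d
      * (3 * ((d%:R ^+ 2 * n%:R ^+ 4 * q ^+ 8) ^+ d * expR 2 ^+ d)))
    = 3 * ('C(n, d)%:R * d%:R ^+ d * (d%:R * n%:R ^+ 5 * q ^+ 8 * expR 2) ^+ d).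
  have XE : d%:R * (d%:R * n%:R ^+ 5 * q ^+ 8 * expR 2)
      = n%:R * (d%:R ^+ 2 * n%:R ^+ 4 * q ^+ 8) * expR 2 :> R by ring.
  rewrite -(mulrA 'C(n, d)%:R) -[d%:R ^+ d * _]exprMn XE.
  move: (d%:R ^+ 2 * n%:R ^+ 4 * q ^+ 8) => P; rewrite 2!(exprMn d).
  by move: (n%:R ^+ d) (P ^+ d) (expR 2 ^+ d) => A B C; ring.
rewrite ler_wpM2l //.
apply: le_trans (ler_wpM2r _ (bin_le R n d)) _.
  by rewrite exprn_ge0 // !mulr_ge0 ?exprn_ge0 ?expR_ge0 ?ltW.
rewrite -exprMn; apply: lerXn2r.
- by rewrite nnegrE !mulr_ge0 ?exprn_ge0 ?expR_ge0 ?ltW.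
- by rewrite nnegrE !mulr_ge0 ?exprn_ge0 ?expR_ge0 ?ltW.
have -> : expR 3 = expR 1 * expR 2 :> R by rewrite -expRD; congr expR; ring.
have -> : expR 1 * n%:R * (d%:R * n%:R ^+ 5 * q ^+ 8 * expR 2)
  = d%:R * (expR 1 * expR 2 * n%:R ^+ 6 * q ^+ 8) :> R by ring.
have -> : expR 1 * expR 2 * (n%:R ^+ 7 * q ^+ 8)
  = n%:R * (expR 1 * expR 2 * n%:R ^+ 6 * q ^+ 8) :> R by ring.
by rewrite ler_wpM2r ?ler_nat // !mulr_ge0 ?exprn_ge0 ?expR_ge0 ?ltW.
Qed.

Lemma geometric_le (n : nat) (x : R) : 0 <= x <= 2^-1 ->
  \sum_(d < n.+1 | (0 < d)%N) x ^+ d <= 2 * x.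
Proof.
move=> /andP[x0 x2]; rewrite big_mkcond big_ord_recl /= add0r.
rewrite (eq_bigr (fun d : 'I_n => x * x ^+ d)) => [|d _]; last first.
  by rewrite exprS.
rewrite -mulr_sumr mulrC ler_wpM2r //.
suff : \sum_(i < n) x ^+ i <= 2 - 2 * x ^+ n.
  by move=> H; apply: le_trans H _; rewrite gerBl mulr_ge0 ?exprn_ge0.
elim: n => [|n IH]; first by rewrite big_ord0 expr0; lra.
rewrite big_ord_recr /=; have := exprn_ge0 n x0; rewrite exprS.
by move: IH; move: (x ^+ n) (\sum_(i < n) _) => a b; nra.
Qed.

(** Outside [D] the map is the identity, so only its values on [D] are free. *)
Lemma moved_count n (D : {set 'I_n}) :
  (#|[set g : {ffun 'I_n -> 'I_n} | moved g == D]| <= n ^ #|D|)%N.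
Proof.
pose F (i : 'I_n) : pred 'I_n := if i \in D then predT else pred1 i.
apply: (@leq_trans #|family F|).
  apply: subset_leq_card; apply/subsetP => g; rewrite inE => /eqP gD.
  apply/familyP => i; rewrite /F -gD inE.
  by case: ifPn => // /negPn/eqP gi; rewrite -topredE /= gi.
rewrite card_family foldrE big_image /=.
rewrite (eq_bigr (fun i => if i \in D then n else 1%N)) => [|i _]; last first.
  by rewrite /F; case: ifP => _; rewrite ?card1 // card_ord.
by rewrite -big_mkcond prod_nat_const.
Qed.

Lemma sum_moved_le n (P : pred {ffun 'I_n -> 'I_n}) (u : nat -> R) :
  (forall g, P g -> moved g != set0) -> (forall d, 0 <= u d) ->
  \sum_(g | P g) u #|moved g|
    <= \sum_(d < n.+1 | (0 < d)%N) 'C(n, d)%:R * (n%:R ^+ d * u d).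
Proof.
move=> Pm u0.
rewrite (partition_big (@moved n) (fun D => D != set0)) //=.
apply: (@le_trans _ _ (\sum_(D : {set 'I_n} | D != set0) n%:R ^+ #|D| * u #|D|)).
  apply: ler_sum => D _.
  apply: (@le_trans _ _ (\sum_(g | moved g == D) u #|D|)).
    rewrite big_mkcond [leRHS]big_mkcond; apply: ler_sum => g _ /=.
    by case: eqP => [<-|_]; rewrite ?andbF // andbT; case: ifP.
  rewrite -[X in \sum_(g | _) X]mul1r -mulr_suml ler_wpM2r // -natrX.
  rewrite (eq_bigl (fun g => g \in [set g | moved g == D])) => [|g]; last by rewrite inE.
  by rewrite sumr_const ler_nat moved_count.
pose sz (D : {set 'I_n}) : 'I_n.+1 := inord #|D|.
have szE D : sz D = #|D| :> nat.
  by rewrite inordK // ltnS -[leqRHS](card_ord n) max_card.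
rewrite (partition_big sz (fun d => (0 < d)%N)) /= => [|D]; last first.
  by rewrite szE lt0n cards_eq0.
apply: ler_sum => d d0.
rewrite (eq_bigr (fun=> n%:R ^+ d * u d)) => [|D /andP[_ /eqP <-]]; last by rewrite szE.
rewrite sumr_const -[leLHS]mulr_natl ler_wpM2r ?mulr_ge0 ?exprn_ge0 //.
have := card_draws 'I_n d; rewrite card_ord => <-; rewrite ler_nat subset_leq_card //.
by apply/subsetP => D; rewrite unfold_in inE => /andP[_ /eqP <-]; rewrite szE.
Qed.

End Numeric.

Section BadEvents.
Variables (R : realType) (n : nat) (p : 'I_n -> 'I_n -> R) (s : R).
Hypothesis hp : edge_probabilities p.
Hypothesis hs : 0 <= s <= 1.

Definition inj_on_moved (g : {ffun 'I_n -> 'I_n}) : bool :=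
  [forall i in moved g, forall j in moved g, (g i == g j) ==> (i == j)].

Lemma inj_on_movedP g : reflect {in moved g &, injective g} (inj_on_moved g).
Proof.
apply: (iffP forall_inP) => [H i j im jm gij|H i im].
  by have /forall_inP/(_ j jm) := H i im; rewrite gij eqxx => /eqP.
by apply/forall_inP => j jm; apply/implyP => /eqP gij; apply/eqP/H.
Qed.

(** Here [t] is the sixteenth root of [n], so that the bound [t ^- 15] on the edge
    probabilities is [n] to the power [-15/16], and [n ^+ 7 * q ^+ 8 = t ^- 8] is
    [n] to the power [-1/2].  Any exponent strictly between [-1] and [-7/8] would do
    in place of [-15/16]. *)
Lemma overlap_union_bound (t : R) : 0 < t -> t ^+ 16 = n%:R -> 1 <= t ->
  expR 3 * t ^- 8 <= 2^-1 -> (forall i j, p i j <= t ^- 15) ->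
  expect p s (fun G _ _ => \sum_(g | inj_on_moved g && (moved g != set0))
       (13 * #|moved g| <= overlap g G)%N%:R)
    <= 6 * (expR 3 * t ^- 8).
Proof.
move=> t0 tn t1 rho2 pq.
set q := t ^- 15 in pq.
have q0 : 0 < q by rewrite invr_gt0 exprn_gt0.
pose Z d : R := (Num.sqrt d%:R * (n%:R * q ^+ 2))^-1.
pose u d : R := 3 * (Z d ^- (4 * d)
  * expR (q ^+ 2 * (d%:R * (n%:R * Z d + d%:R * Z d ^+ 2)))).
have Z0 d : 0 <= Z d by rewrite invr_ge0 !mulr_ge0 ?sqrtr_ge0 ?exprn_ge0 ?(ltW q0).
have u0 d : 0 <= u d.
  by rewrite !mulr_ge0 ?expR_ge0 ?invr_ge0 ?exprn_ge0.
rewrite (expect_sum p s (fun g => inj_on_moved g && (moved g != set0))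
  (fun g G _ _ => (13 * #|moved g| <= overlap g G)%N%:R)).
apply: (@le_trans _ _ (\sum_(g | inj_on_moved g && (moved g != set0)) u #|moved g|)).
  apply: ler_sum => g /andP[/inj_on_movedP ginj gm].
  have d0 : (0 < #|moved g| <= n)%N.
    by rewrite lt0n cards_eq0 gm -[leqRHS](card_ord n) max_card.
  rewrite /u; apply: overlap_tail => //.
  have /andP[d0' dn] := d0.
  rewrite /Z invf_ge1; last first.
    by rewrite !mulr_gt0 ?exprn_gt0 ?sqrtr_gt0 ?ltr0n // (leq_trans d0').
  have Zi0 : 0 <= Num.sqrt #|moved g|%:R * (n%:R * q ^+ 2) :> R.
    by rewrite !mulr_ge0 ?sqrtr_ge0 ?exprn_ge0 ?(ltW q0).
  rewrite -(@ler_pXn2r _ 2) ?nnegrE //.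
  rewrite expr1n exprMn sqr_sqrtr ?ler0n //.
  apply: (@le_trans _ _ (n%:R * (n%:R * q ^+ 2) ^+ 2)).
    by rewrite ler_wpM2r ?ler_nat // exprn_ge0 // mulr_ge0 // exprn_ge0 // (ltW q0).
  have -> : n%:R * (n%:R * q ^+ 2) ^+ 2 = t ^- 12.
    rewrite -tn /q; field; exact: lt0r_neq0.
  by rewrite invf_le1 ?exprn_gt0 // exprn_ege1.
apply: le_trans (sum_moved_le _ u0) _; first by move=> g /andP[].
apply: (@le_trans _ _ (\sum_(d < n.+1 | (0 < d)%N) 3 * (expR 3 * t ^- 8) ^+ d)).
  apply: ler_sum => d d0; have dn : (0 < d <= n)%N by rewrite d0 -ltnS ltn_ord.
  have -> : t ^- 8 = n%:R ^+ 7 * q ^+ 8.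
    by rewrite -tn /q; field; exact: lt0r_neq0.
  rewrite /u; apply: overlap_union_term_le => //.
  have -> : n%:R * q = t by rewrite -tn /q; field; exact: lt0r_neq0.
  exact: t1.
rewrite -mulr_sumr (_ : 6 = 3 * 2); last by ring.
rewrite -mulrA ler_wpM2l // geometric_le // rho2 andbT.
by rewrite mulr_ge0 ?expR_ge0 // invr_ge0 exprn_ge0 // ltW.
Qed.

End BadEvents.

(** * Core matchings outside the bad events *)

Section Deterministic.
Variable n : nat.

Lemma adj_relabel (pi : 'S_n) (G : sgraph n) i j :
  adj (relabel pi G) i j = adj G (pi^-1 i)%g (pi^-1 j)%g.
Proof.
rewrite /adj /=; apply/imsetP/idP => [[e eG E]|].
  suff -> : [set (pi^-1)%g i; (pi^-1)%g j] = e by [].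
  apply: (imset_inj (@perm_inj _ pi)).
  by rewrite -E imsetU !imset_set1 !permKV.
move=> eG; exists [set (pi^-1)%g i; (pi^-1)%g j] => //.
by rewrite imsetU !imset_set1 !permKV.
Qed.

(** In terms of [g], the composite of [mmap m] with [pi^-1], a neighbour [j] of
    [i] in the wedge gives two edges [{i, j}] and [{g i, g j}] of the parent graph.
    If [m] disagreed with [pi], the moved vertices would give [g] an overlap of at
    least [k] for each of them. *)
Lemma core_matching_correct k (G G1 G2 : sgraph n) (pi : 'S_n) (m : matching n) :
  edges G1 \subset edges G -> edges G2 \subset edges G ->
  core_matching k G1 (relabel pi G2) m ->
  (forall g : {ffun 'I_n -> 'I_n}, {in moved g &, injective g} -> moved g != set0 ->
     (overlap g G < k * #|moved g|)%N) ->
  graph_of (mmap m) (mdom m) = graph_of pi (mdom m).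
Proof.
move=> /subsetP G1G /subsetP G2G mcore noov.
pose g := [ffun i => if i \in mdom m then (pi^-1)%g (mmap m i) else i].
have gE i : i \in mdom m -> g i = (pi^-1)%g (mmap m i) by move=> im; rewrite ffunE im.
have gm i : i \in moved g -> i \in mdom m.
  by rewrite inE ffunE; case: ifP => //; rewrite eqxx.
have ginj : {in mdom m &, injective g}.
  by move=> i j im jm; rewrite !gE // => /perm_inj; apply: mmap_inj.
have [g0|gN] := eqVneq (moved g) set0.
  apply: eq_in_imset => i im; congr pair.
  have : i \notin moved g by rewrite g0 inE.
  by rewrite inE negbK gE // => /eqP /(congr1 pi); rewrite permKV.
have ginj' : {in moved g &, injective g} by move=> i j /gm im /gm jm; exact: ginj.
have := noov g ginj' gN; rewrite ltnNge => /negP[].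
rewrite mulnC -sum_nat_const; apply: leq_sum => i im.
apply: leq_trans (mcore i (gm i im)) _; apply: subset_leq_card; apply/subsetP => j.
rewrite inE => /and4P[iM jM ij]; rewrite adj_relabel -!gE // => gij.
rewrite inE (G1G _ ij) (G2G _ gij) !andbT inE.
have [//|jN] := boolP (j \in moved g); apply/imsetP => -[i' i'm ji].
move: (jN); rewrite inE negbK => /eqP gj.
by move: jN; rewrite (ginj j i' jM (gm _ i'm)) ?i'm // gj.
Qed.

Lemma exists_large_core_matching k (G1 G2 : sgraph n) (pi : 'S_n) x :
  (forall S : {set 'I_n}, #|S| = x ->
     (k * x < #|edges G1 :&: edges G2 :&: touching S|)%N) ->
  exists m : matching n, core_matching k.+1 G1 (relabel pi G2) m /\
     (n - x <= #|mdom m|)%N.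
Proof.
move=> many.
have HE : edges G1 :&: edges G2 \subset vertex_pairs n.
  exact: subset_trans (subsetIl _ _) (edges_vertex_pairs _).
have [[M [Mx HM]]|[S [Sx]]] := peeling k x HE; last by rewrite leqNgt many.
have pinj : {in M &, injective pi} by move=> i j _ _; exact: perm_inj.
exists (Matching pinj); split => // i iM; apply: leq_trans (HM i iM) _.
apply: subset_leq_card; apply/subsetP => j; rewrite !inE => /and3P[jM ij1 ij2].
by rewrite /wedge /= iM jM adj_relabel !permK /adj ij1 ij2.
Qed.

End Deterministic.

(** * The estimator for a fixed number of vertices, and the limit *)

Section Limits.
Variable R : realType.

Lemma cvg_invsqrt : ((fun n => (Num.sqrt (n%:R : R))^-1) @ \oo --> (0 : R))%classic.
Proof.
rewrite -(cvg_shiftS (fun n => (Num.sqrt (n%:R : R))^-1)) /=.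
rewrite (_ : (fun n => _) = Num.sqrt \o @harmonic R); last first.
  by apply/funext => n; rewrite /= sqrtrV ?ler0n.
suff : ((Num.sqrt \o @harmonic R) @ \oo --> Num.sqrt (0 : R))%classic by rewrite sqrtr0.
by apply: continuous_cvg; [exact: sqrt_continuous|exact: cvg_harmonic].
Qed.

End Limits.

Lemma row_sum_ge (R : realType) n (p : 'I_n -> 'I_n -> R) i :
  (forall i j, 0 <= p i j) -> min_row_sum p <= \sum_j p i j.
Proof.
move=> p0; apply: ge_inf; last by exists i.
by exists 0 => _ [j _ <-]; apply: sumr_ge0.
Qed.

Lemma le_pmax (R : realType) n (p : 'I_n -> 'I_n -> R) i j : p i j <= pmax p.
Proof.
rewrite /pmax; apply: le_trans (le_bigmax _ _ i) => /=.
exact: (le_bigmax _ (fun j => p i j)).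
Qed.

Section FixedSize.
Variables (R : realType) (n : nat) (p : 'I_n -> 'I_n -> R) (s lam t : R).
Variable est : sgraph n -> sgraph n -> matching n.
Hypothesis hp : edge_probabilities p.
Hypothesis hs : 0 <= s <= 1.
Hypothesis hest : core_estimator 13 est.

(** The integer [x] exceeds [3 exp (- lam / 7) n] by about [sqrt n = t ^+ 8]: this
    makes the bound [2^-x] on the failure of the core tend to 0 whatever the size of
    [lam], at the price of a loss [t ^+ 8 + 1 = o(n)] in the size. *)
Lemma corr_prob_estimator_ge :
  0 < t -> t ^+ 16 = n%:R -> 1 <= t -> expR 3 * t ^- 8 <= 2^-1 ->
  (forall i j, p i j <= t ^- 15) ->
  154 <= lam -> (forall i, lam <= \sum_j p i j * s ^+ 2) ->
  1 - (6 * expR 3 + 1) * t ^- 8 <=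
  corr_prob p s (fun G1 G2 pi =>
    ((1 - 3 * expR (- (lam / 7))) * n%:R - (t ^+ 8 + 1) <= #|mdom (est G1 G2)|%:R)
    && (graph_of (mmap (est G1 G2)) (mdom (est G1 G2))
         == graph_of pi (mdom (est G1 G2)))).
Proof.
move=> t0 tn t1 rho pt lam154 hlam.
pose w := 3 * expR (- (lam / 7)) * n%:R + t ^+ 8.
have w0 : 0 <= w by rewrite addr_ge0 ?mulr_ge0 ?expR_ge0 ?exprn_ge0 ?ler0n ?(ltW t0).
pose x := (Num.trunc w).+1.
have wx : w <= x%:R by rewrite ltW // truncnS_gt.
have xw : x%:R <= w + 1 by rewrite -natr1 lerD2r truncn_le.
have b1 := overlap_union_bound hp hs t0 tn t1 rho pt.
have b2 := expect_few_touching_sets_le hp hs x (12 * x) hlam.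
set B1 := (X in expect p s X <= _) in b1.
set B2 := (X in expect p s X <= _) in b2.
have b2' : expect p s B2 <= t ^- 8.
  apply: le_trans b2 _; apply: le_trans (core_union_term_le _ lam154 _) _ => //.
    by apply: le_trans wx; rewrite lerDl exprn_ge0 // ltW.
  rewrite exprVn lef_pV2 ?posrE ?exprn_gt0 //.
  apply: (@le_trans _ _ x%:R).
    by apply: le_trans wx; rewrite lerDr !mulr_ge0 ?expR_ge0.
  by rewrite -natrX ler_nat ltnW // ltn_expl.
apply: (@le_trans _ _ (1 - (expect p s B1 + expect p s B2))).
  by rewrite lerD2l lerN2 mulrDl mul1r -mulrA lerD.
apply: corr_prob_ge => // [G G1 G2|G G1 G2|G G1 G2 pi G1G G2G].
- by apply: sumr_ge0.
- by apply: sumr_ge0.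
apply: contraR; rewrite -ltNge => B12.
have B1_0 : 0 <= B1 G G1 G2 by apply: sumr_ge0.
have B2_0 : 0 <= B2 G G1 G2 by apply: sumr_ge0.
have {}b1 : B1 G G1 G2 < 1 by apply: le_lt_trans B12; rewrite lerDl.
have {}b2 : B2 G G1 G2 < 1 by apply: le_lt_trans B12; rewrite lerDr.
have [core max] := hest G1 (relabel pi G2).
apply/andP; split; last first.
  apply/eqP; apply: core_matching_correct G1G G2G core _ => g ginj gm.
  rewrite ltnNge; apply/negP => ov; move: b1; rewrite ltNge => /negP[].
  rewrite /B1 (bigD1 g) /= ?ov; last by rewrite gm andbT; apply/inj_on_movedP.
  by rewrite lerDl sumr_ge0.
have [m [mcore mx]] : exists m : matching n,
    core_matching 13 G1 (relabel pi G2) m /\ (n - x <= #|mdom m|)%N.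
  apply: exists_large_core_matching => S Sx; rewrite ltnNge; apply/negP => few.
  move: b2; rewrite ltNge => /negP[]; rewrite /B2 (bigD1 S) /= ?Sx // few.
  by rewrite lerDl sumr_ge0.
have nx : (n <= #|mdom (est G1 (relabel pi G2))| + x)%N.
  by rewrite addnC -leq_subLR (leq_trans mx) ?max.
move: nx; rewrite -(ler_nat R) natrD /= => nx.
by move: xw; rewrite /w; lra.
Qed.

End FixedSize.

Local Open Scope classical_set_scope.
Local Open Scope ring_scope.

Theorem theorem2 (R : realType)
    (p : forall n : nat, 'I_n -> 'I_n -> R) (s : nat -> R)
    (est : forall n : nat, sgraph n -> sgraph n -> matching n)
    (hp : forall n, edge_probabilities (p n))
    (hs : forall n, 0 <= s n <= 1)
    (hpmax : exists eps : nat -> R, (eps @ \oo --> (0 : R)) /\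
       \forall n \near \oo, pmax (p n) = n%:R `^ (- 1 + eps n))
    (hest : forall n, core_estimator 13 (est n))
    (hdeg : \forall n \near \oo,
       Num.max (heterogeneity (p n)) 154
         <= min_row_sum (fun i j => p n i j * s n ^+ 2)) :
  exists a : nat -> R, ((fun n => a n / n%:R) @ \oo --> (0 : R)) /\
    (fun n => corr_prob (p n) (s n) (fun G1 G2 pi =>
       let m := est n G1 G2 in
       ((1 - 3 * expR (- (min_row_sum (fun i j => p n i j * s n ^+ 2) / 7)))
            * n%:R - a n <= #|mdom m|%:R)
       && (graph_of (mmap m) (mdom m) == graph_of pi (mdom m))))
    @ \oo --> (1 : R).
Proof.
have w0 := @cvg_invsqrt R.
exists (fun n => Num.sqrt n%:R + 1); split.
  rewrite (_ : (fun n => _) = (fun n =>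
      (Num.sqrt n%:R)^-1 + (Num.sqrt n%:R)^-1 * (Num.sqrt n%:R)^-1)).
    by have := cvgD w0 (cvgM w0 w0); rewrite mulr0 addr0; apply.
  apply/funext => n; case: n => [|n].
    by rewrite sqrtr0 !invr0 !mulr0 addr0.
  have n0 : 0 < n.+1%:R :> R by rewrite ltr0n.
  have r0 : 0 < Num.sqrt n.+1%:R :> R by rewrite sqrtr_gt0.
  have := sqr_sqrtr (ltW n0); move: (Num.sqrt _) r0 => r r0 <-.
  by field; rewrite gt_eqF.
have [eps [eps0 pmaxE]] := hpmax.
apply: (@squeeze_cvgr _ _ _ _
  (fun n => 1 - (6 * expR 3 + 1) * (Num.sqrt n%:R)^-1) (fun=> 1)); last 2 first.
- suff : (fun n => 1 - (6 * expR 3 + 1) * (Num.sqrt n%:R)^-1) @ \oo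
      --> (1 - (6 * expR 3 + 1) * 0 : R) by rewrite mulr0 subr0.
  by apply: cvgB; [exact: cvg_cst|apply: cvgM => //; exact: cvg_cst].
- exact: cvg_cst.
near=> n.
have n1 : (0 < n)%N by near: n; exists 1%N.
have nR0 : 0 < n%:R :> R by rewrite ltr0n.
pose t : R := n%:R `^ (16%:R^-1).
have t0 : 0 < t by rewrite powR_gt0.
have tn : t ^+ 16 = n%:R.
  by rewrite -powR_mulrn ?(ltW t0) // -powRrM mulVf // powRr1 // ltW.
have t1 : 1 <= t.
  by rewrite -(@expr_ge1 _ 16) ?(ltW t0) // tn ler1n.
have t8 : t ^+ 8 = Num.sqrt n%:R.
  by rewrite -tn (exprM t 8 2) sqrtr_sqr ger0_norm // exprn_ge0 // ltW.
rewrite corr_prob_le1 // andbT -t8.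
have hlam : Num.max (heterogeneity (p n)) 154
    <= min_row_sum (fun i j => p n i j * s n ^+ 2) by near: n.
apply: corr_prob_estimator_ge => //.
- rewrite t8 mulrC -ler_pdivlMr ?expR_gt0 //.
  near: n; apply: (cvgr_le _ w0).
  by rewrite divr_gt0 ?expR_gt0 // invr_gt0.
- move=> i j; apply: le_trans (le_pmax (p n) i j) _.
  have -> : pmax (p n) = n%:R `^ (- 1 + eps n) by near: n.
  have -> : t ^- 15 = n%:R `^ (- (15%:R / 16%:R)).
    by rewrite powRN -powR_mulrn ?(ltW t0) // -powRrM mulrC.
  apply: ler_powR; first by rewrite ler1n.
  have : eps n <= 16%:R^-1.
    near: n; apply: (cvgr_le _ eps0); by rewrite invr_gt0.
  lra.
- by move: hlam; rewrite ge_max => /andP[].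
move=> i; apply: (@row_sum_ge _ _ (fun i j => p n i j * s n ^+ 2) i) => k j.
by have [p01 _ _] := hp n; case/andP: (p01 k j) => ? _; rewrite mulr_ge0 ?sqr_ge0.
Unshelve. all: by end_near.
Qed.
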